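(* Let $m$ and $n$ be positive integers with $m\ge 3$ and $n\ge 3$. Then: (a) $i(P_m\times K_2)=2\lceil \frac{m}{3}\rceil$. (b) $i(C_m\times K_2)=\lceil \frac{2m}{3}\rceil$ if $m$ is odd, and $i(C_m\times K_2)=2\lceil \frac{m}{3}\rceil$ if $m$ is even. (c) $i(C_m\times K_n)=m$ for $3\le m\le 5$, and $i(C_m\times K_n)=\left\lceil \frac{2m}{3}\right\rceil$ for every $m\ge 6$. (d) $i(P_m\times K_n)=\left\lceil \frac{2m+2}{3}\right\rceil$.
   Context: All graphs are finite, simple and undirected. $P_m$, $C_m$ and $K_n$ denote the path on $m$ vertices, the cycle on $m$ vertices and the complete graph on $n$ vertices. The independent domination number $i(G)$ of a graph $G$ is the minimum cardinality of a set $I\subseteq V(G)$ that is independent and dominating (every vertex is in $I$ or adjacent to a vertex of $I$); equivalently, the minimum cardinality of a maximal independent set of $G$. The direct product $G\times H$ has vertex set $V(G)\times V(H)$ and edge set $\{(g_1,h_1)(g_2,h_2) : g_1g_2\in E(G)\text{ and } h_1h_2\in E(H)\}$. *)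

(* Defs.v *)
From mathcomp Require Import all_boot.

Set Implicit Arguments.
Unset Strict Implicit.
Unset Printing Implicit Defensive.

Record sgraph := SGraph {
  vertex :> finType;
  edge : rel vertex;
  edge_sym : symmetric edge;
  edge_irrefl : irreflexive edge
}.

Definition independent (G : sgraph) (A : {set G}) : bool :=
  [forall x in A, forall y in A, ~~ edge x y].

Definition dominating (G : sgraph) (A : {set G}) : bool :=
  [forall x, (x \in A) || [exists y in A, edge x y]].

Lemma max_independent_dominating (G : sgraph) (A : {set G}) :
  maxset (@independent G) A -> independent A && dominating A.
Proof.
case/maxsetP => indA maxA; rewrite indA /=.
apply/forallP => x; case: (boolP (x \in A)) => //= xNA.
apply: contraR xNA => /exists_inPn nbr.
rewrite -(maxA (x |: A)) ?setU11 ?subsetUr //.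
apply/forall_inP => u /setU1P[->|uA]; apply/forall_inP => v /setU1P[->|vA].
- by rewrite edge_irrefl.
- exact: nbr.
- by rewrite edge_sym nbr.
- by move/forall_inP: indA => /(_ u uA)/forall_inP/(_ v vA).
Qed.

Lemma ind_dom_exists (G : sgraph) :
  exists k, [exists A : {set G}, [&& independent A, dominating A & #|A| == k]].
Proof.
have ind0 : @independent G set0.
  by apply/forall_inP => x; rewrite inE.
have [A maxA _] := maxset_exists ind0.
exists #|A|; apply/existsP; exists A.
by case/andP: (max_independent_dominating maxA) => -> ->; rewrite eqxx.
Qed.

Definition ind_dom_number (G : sgraph) : nat := ex_minn (ind_dom_exists G).

Section Path.
Variable m : nat.

Definition path_edge : rel 'I_m := fun x y => (x.+1 == y) || (y.+1 == x).

Lemma path_edge_sym : symmetric path_edge.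
Proof. by move=> x y; rewrite /path_edge orbC. Qed.

Lemma path_edge_irrefl : irreflexive path_edge.
Proof. by move=> x; rewrite /path_edge orbb gtn_eqF. Qed.

Definition path_graph := SGraph path_edge_sym path_edge_irrefl.

End Path.

Section Cycle.
Variable m : nat.

(* The conjunct [x != y] only matters for m = 1, where it removes the loop. *)
Definition cycle_edge : rel 'I_m :=
  fun x y => (x != y) && ((x.+1 == y %[mod m]) || (y.+1 == x %[mod m])).

Lemma cycle_edge_sym : symmetric cycle_edge.
Proof. by move=> x y; rewrite /cycle_edge orbC eq_sym. Qed.

Lemma cycle_edge_irrefl : irreflexive cycle_edge.
Proof. by move=> x; rewrite /cycle_edge eqxx. Qed.

Definition cycle_graph := SGraph cycle_edge_sym cycle_edge_irrefl.

End Cycle.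

Section Complete.
Variable n : nat.

Definition complete_edge : rel 'I_n := fun x y => x != y.

Lemma complete_edge_sym : symmetric complete_edge.
Proof. by move=> x y; rewrite /complete_edge eq_sym. Qed.

Lemma complete_edge_irrefl : irreflexive complete_edge.
Proof. by move=> x; rewrite /complete_edge eqxx. Qed.

Definition complete_graph := SGraph complete_edge_sym complete_edge_irrefl.

End Complete.

Section DirectProduct.
Variables G H : sgraph.

Definition dprod_edge : rel (G * H)%type :=
  fun u v => edge u.1 v.1 && edge u.2 v.2.

Lemma dprod_edge_sym : symmetric dprod_edge.
Proof.
by move=> u v; rewrite /dprod_edge (edge_sym u.1) (edge_sym u.2).
Qed.

Lemma dprod_edge_irrefl : irreflexive dprod_edge.
Proof. by move=> u; rewrite /dprod_edge edge_irrefl. Qed.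

Definition direct_product := SGraph dprod_edge_sym dprod_edge_irrefl.

End DirectProduct.

(* The ceiling of the rational a / b, for b > 0; see [ceil_div_leq]. *)
Definition ceil_div (a b : nat) : nat := (a + b.-1) %/ b.

Lemma ceil_div_leq a b k : 0 < b -> (ceil_div a b <= k) = (a <= k * b).
Proof.
case: b => // b _.
by rewrite /ceil_div -ltnS ltn_divLR // mulSn addSn addnC /= ltnS leq_add2l.
Qed.

(* Main.v *)
Require Import Defs.
From mathcomp Require Import all_boot.
From mathcomp Require Import zify.

Set Implicit Arguments.
Unset Strict Implicit.
Unset Printing Implicit Defensive.

(** Lower bounds come from a double count.  For a dominating set [I] of the
    direct product of [G] and [K_n], let [near I x] be the part of [I] lying
    over the closed neighbourhood of the vertex [x] of [G].  Summing the sizes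
    of these parts over [x] counts each point of [I] once for every vertex in
    the closed neighbourhood of its first coordinate ([sum_near]), so at most
    three times over a path or a cycle.  Each part has at least two points as
    soon as [n] is at least 2 ([near_geq2]): one point alone cannot dominate
    the whole column over [x].  This gives the bound [2m/3] for all cycles
    ([cycle_geq]), which is sharp in (b) for odd [m] and in (c) for large [m].

    The other bounds refine it.
    - Over a path the points in the two end columns are counted only twice, and
      an empty end column forces its neighbour to be full, which is just as
      costly ([leaf_sum_near], [path_card_geq]): this yields the extra [2/3]
      in (d).
    - If [G] is bipartite, the product with [K_2] consists of two copies of
      [G], and a dominating set splits into a dominating set of each
      ([ind_dom_number_bipartite]).
    - On a cycle of length at most 5, an independent dominating set that leaves
      a column empty and has no two points in a column would contain two runs
      of different colours starting on both sides of the empty column; there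
      is not enough room for them ([small_cycle_geq]).

    Upper bounds come from explicit sets.  When every column contains at most
    one point, the set is a partial colouring of [G], and it is independent and
    dominating when coloured vertices agree with their coloured neighbours and
    have at least one, while uncoloured vertices see two colours
    ([ind_dom_number_colouring]).  The colouring [aa_bb_aa_...] of density
    [2/3], with its first run lengthened by [m mod 3] cells, does this on a
    cycle; removing its last, uncoloured cell from the cycle of length [m + 1]
    leaves the colouring for the path on [m] vertices, which is why the value
    in (d) is that of (c) at [m + 1].  With [K_2], the sets are either [D x K_2]
    for a sparse [D] ([sparse_set]), or, for odd [m], the image of a sparse set
    of the cycle of length [2m], to which the product is isomorphic by the
    Chinese remainder theorem ([odd_cycle_K2_leq]). *)

(** * Independent domination *)

Section IndDom.
Variable G : sgraph.
Implicit Types (A : {set G}) (x y : G).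

Lemma independentP A :
  reflect {in A &, forall x y, ~~ edge x y} (independent A).
Proof.
apply: (iffP forall_inP) => [h x y xA yA|h x xA].
  by move/forall_inP: (h x xA); apply.
by apply/forall_inP => y; apply: h.
Qed.

Lemma dominatingP A :
  reflect (forall x, x \notin A -> exists2 y, y \in A & edge x y)
          (dominating A).
Proof.
apply: (iffP forallP) => [h x xNA|h x].
  by move: (h x); rewrite (negbTE xNA) => /exists_inP.
by case: (boolP (x \in A)) => //= /h /exists_inP.
Qed.

Lemma ind_dom_number_leq A :
  independent A -> dominating A -> ind_dom_number G <= #|A|.
Proof.
move=> iA dA; rewrite /ind_dom_number; case: ex_minnP => k _; apply.
by apply/existsP; exists A; rewrite iA dA eqxx.
Qed.

Lemma leq_ind_dom_number k :
  (forall A, independent A -> dominating A -> k <= #|A|) ->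
  k <= ind_dom_number G.
Proof.
move=> h; rewrite /ind_dom_number; case: ex_minnP => j /existsP[A].
by case/and3P => iA dA /eqP<- _; apply: h.
Qed.

Definition cnbhd x : {set G} := [set y | (y == x) || edge x y].

Lemma in_cnbhd x y : (y \in cnbhd x) = (y == x) || edge x y.
Proof. by rewrite inE. Qed.

Lemma cnbhd_sym x y : (y \in cnbhd x) = (x \in cnbhd y).
Proof. by rewrite !inE eq_sym edge_sym. Qed.

End IndDom.

Lemma ind_dom_number_iso_leq (G H : sgraph) (f : G -> H) :
  bijective f -> (forall x y, edge (f x) (f y) = edge x y) ->
  ind_dom_number H <= ind_dom_number G.
Proof.
move=> bf ef; apply: leq_ind_dom_number => A /independentP iA /dominatingP dA.
rewrite -(card_imset _ (bij_inj bf)); apply: ind_dom_number_leq.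
  apply/independentP => _ _ /imsetP[x xA ->] /imsetP[y yA ->].
  by rewrite ef iA.
case: bf => g fK gK; apply/dominatingP => y; rewrite -(gK y).
rewrite (mem_imset _ _ (can_inj fK)) => /dA[z zA e].
by exists (f z); rewrite ?ef // imset_f.
Qed.

(** * Direct products with a complete graph *)

Section Product.
Variables (G : sgraph) (n : nat).
Local Notation GK := (direct_product G (complete_graph n)).
Implicit Types (I : {set GK}) (x y : G) (a b c : 'I_n).

Lemma prod_edgeE x a y b :
  edge ((x, a) : GK) ((y, b) : GK) = edge x y && (a != b).
Proof. by []. Qed.

(** The points of [I] that can take part in dominating the column over [x]. *)
Definition near I x : {set GK} := [set p in I | p.1 \in cnbhd x].

Lemma sum_near I : \sum_x #|near I x| = \sum_(p in I) #|cnbhd p.1|.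
Proof.
transitivity (\sum_x \sum_(p in I) (p.1 \in cnbhd x : nat)).
  apply: eq_bigr => x _; rewrite -sum1_card big_mkcond [RHS]big_mkcond /=.
  by apply: eq_bigr => p _; rewrite !inE; case: (p \in I); case: (_ || _).
rewrite exchange_big; apply: eq_bigr => p _ /=.
rewrite -sum1_card [RHS]big_mkcond /=.
by apply: eq_bigr => x _; rewrite cnbhd_sym; case: (_ \in _).
Qed.

Lemma sum_near_leq I :
  (forall x, #|cnbhd x| <= 3) -> \sum_x #|near I x| <= 3 * #|I|.
Proof.
move=> d; rewrite sum_near mulnC -sum_nat_const.
by apply: leq_sum => p _; apply: d.
Qed.

Lemma near_dominator I x a : dominating I ->
  exists2 p, p \in near I x & if p.1 == x then p.2 == a else p.2 != a.
Proof.
move=> /dominatingP dI; case: (boolP ((x, a) \in I)) => [xI|/dI[[y b] yI]].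
  by exists (x, a); rewrite ?inE ?xI !eqxx.
rewrite prod_edgeE => /andP[e ab]; exists (y, b); first by rewrite !inE yI e orbT.
by rewrite /= eq_sym; case: eqP e => [->|_ _]; rewrite ?edge_irrefl // eq_sym.
Qed.

(** A single point [(y, b)] over the closed neighbourhood of [x] leaves a vertex
    of the column over [x] undominated: [(x, b)] if [y] differs from [x], and
    any other vertex of the column if [y = x]. *)
Lemma near_geq2 I x : 1 < n -> dominating I -> 1 < #|near I x|.
Proof.
move=> n2 dI; pose o := Ordinal (ltnW n2); pose o' := Ordinal n2.
case: (near_dominator x o dI) => -[y b] up _.
(* the second coordinate of a vertex over [x] that [(y, b)] does not dominate *)
pose c := if y == x then (if b == o then o' else o) else b.
case: (near_dominator x c dI) => v vp vc.
have uv : (y, b) != v.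
  apply: contraL vc => /eqP <- /=; rewrite /c.
  by case: (y == x); rewrite ?negbK //; case: (eqVneq b o) => [->|].
rewrite -(_ : #|[set ((y, b) : GK); v]| = 2); last by rewrite cards2 uv.
by apply: subset_leq_card; apply/subsetP => p /set2P[]->.
Qed.

Lemma sum_near_geq I : 1 < n -> dominating I -> 2 * #|G| <= \sum_x #|near I x|.
Proof.
move=> n2 dI; rewrite mulnC -sum_nat_const.
by apply: leq_sum => x _; apply: near_geq2.
Qed.

Lemma ind_dom_number_prod_geq :
  1 < n -> (forall x, #|cnbhd x| <= 3) -> ceil_div (2 * #|G|) 3 <= ind_dom_number GK.
Proof.
move=> n2 d; apply: leq_ind_dom_number => I _ dI.
rewrite ceil_div_leq // (mulnC #|I|).
exact: leq_trans (sum_near_geq n2 dI) (sum_near_leq _ d).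
Qed.

(** A neighbour of a vertex in the column over [x] would be adjacent to [(x, a)]
    or to [(x, b)], since its second coordinate differs from [a] or from [b];
    so the column can only be dominated by itself. *)
Lemma column_full I x a b : independent I -> dominating I ->
  (x, a) \in I -> (x, b) \in I -> a != b -> forall c, (x, c) \in I.
Proof.
move=> /independentP iI /dominatingP dI xa xb ab c; apply: contraT.
move=> /dI[[y d] yd]; rewrite prod_edgeE => /andP[e _].
move: (iI _ _ xa yd) (iI _ _ xb yd); rewrite !prod_edgeE e /= !negbK.
by move=> /eqP aE /eqP bE; rewrite aE bE eqxx in ab.
Qed.

Definition column x : {set GK} := [set p | p.1 == x].

Lemma card_column x : #|column x| = n.
Proof.
rewrite -[RHS]card_ord -[RHS](card_imset 'I_n (f := fun a => (x, a) : GK)).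
  apply: eq_card => -[y a]; rewrite inE /=; apply/eqP/imsetP => [->|[b _ [-> _]]//].
  by exists a.
by move=> a b [].
Qed.

(** Only the column over [y] can dominate the empty column over the leaf [x], so
    it has two points and is therefore full.  Both [near I x] and [near I y]
    then contain these [n] points, one more than the generic bound. *)
Lemma leaf_sum_near I x y : 2 < n -> independent I -> dominating I ->
  x != y -> cnbhd x \subset [set x; y] -> edge x y ->
  (forall a, (x, a) \notin I) -> 2 * #|G| + 2 <= \sum_z #|near I z|.
Proof.
move=> n3 iI dI xy sx e xN.
have dom a : exists2 b, (y, b) \in I & b != a.
  case: (near_dominator x a dI) => -[z b]; rewrite inE => /andP[zI /(subsetP sx)] /=.
  case/set2P => zE; rewrite zE in zI *; first by rewrite (negbTE (xN b)) in zI.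
  by rewrite eq_sym (negbTE xy); exists b.
case: (dom (Ordinal (ltnW (ltnW n3)))) => a ya _; case: (dom a) => b yb ba.
have full := column_full iI dI yb ya ba.
have big z : z \in cnbhd y -> 2 < #|near I z|.
  rewrite cnbhd_sym => yz; apply: leq_trans n3 _.
  apply: leq_trans (eq_leq (esym (card_column y))) _.
  apply: subset_leq_card; apply/subsetP => -[w c].
  by rewrite !inE /= => /eqP->; rewrite full -in_cnbhd.
rewrite (bigD1 x) //= (bigD1 y) 1?eq_sym //= addnA.
have -> : #|G| = (#|[pred z | (z != x) && (z != y)]|).+2.
  rewrite (cardD1 x) (cardD1 y) !inE eq_sym xy /= add1n add1n; congr _.+2.
  by apply: eq_card => z; rewrite !inE andbT andbC.
have b1 : 2 < #|near I x| by apply: big; rewrite inE (edge_sym y) e orbT.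
have b2 : 2 < #|near I y| by apply: big; rewrite inE eqxx.
have b3 : 2 * #|[pred z | (z != x) && (z != y)]| <=
          \sum_(z | (z != x) && (z != y)) #|near I z|.
  rewrite mulnC -sum_nat_const.
  by apply: leq_sum => z _; apply: near_geq2 => //; apply: ltnW.
by apply: leq_trans (leq_add (leq_add b1 b2) b3); rewrite !mulnS; lia.
Qed.

(** The set consists of the points [(x, col x)] with [x] live.  A live vertex
    needs a live neighbour to dominate the rest of its column; a dead one needs
    two colours around it, because a neighbour coloured [b] dominates all of the
    column except the vertex with second coordinate [b]. *)
Lemma ind_dom_number_colouring (live : pred G) (col : G -> 'I_n) :
  (forall x y, live x -> live y -> edge x y -> col x = col y) ->
  (forall x, live x -> exists2 y, live y & edge x y) ->
  (forall x, ~~ live x -> exists y z,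
      [/\ live y, live z, edge x y, edge x z & col y != col z]) ->
  ind_dom_number GK <= #|live|.
Proof.
move=> h1 h2 h3; pose f x : GK := (x, col x).
have fI x a : ((x, a) \in f @: live) = live x && (a == col x).
  apply/imsetP/andP => [[y yl [-> ->]]|[xl /eqP->]]; first by rewrite eqxx.
  by exists x.
have injf : injective f by move=> x y [].
rewrite -(card_imset _ injf); apply: ind_dom_number_leq.
  apply/independentP => -[x a] [y b]; rewrite !fI prod_edgeE.
  move=> /andP[xl /eqP->] /andP[yl /eqP->]; apply/nandP.
  by case: (boolP (edge x y)) => [/h1->//|_]; [rewrite eqxx; right | left].
apply/dominatingP => -[x a]; rewrite fI; case: (boolP (live x)) => [xl ca|].
  case: (h2 x xl) => y yl e; exists (y, col y); first by rewrite fI yl eqxx.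
  by rewrite prod_edgeE e -(h1 x y).
case/h3 => y [z] [yl zl ey ez yz].
case: (eqVneq a (col y)) => [aE|aN]; last first.
  by exists (y, col y); rewrite ?fI ?yl ?eqxx // prod_edgeE ey.
by exists (z, col z); rewrite ?fI ?zl ?eqxx // prod_edgeE ez aE.
Qed.

Lemma ind_dom_number_prod_leq (D : {set G}) : 1 < n ->
  independent D -> dominating D -> ind_dom_number GK <= #|D| * n.
Proof.
move=> n2 /independentP iD /dominatingP dD.
rewrite -[n in _ * n]card_ord -cardsT -cardsX; apply: ind_dom_number_leq.
  apply/independentP => -[x a] [y b] /setXP[xD _] /setXP[yD _].
  by rewrite prod_edgeE negb_and iD.
apply/dominatingP => -[x a]; rewrite in_setX inE andbT => /dD[y yD e].
pose b : 'I_n := if a == Ordinal n2 then Ordinal (ltnW n2) else Ordinal n2.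
exists (y, b); first by rewrite in_setX yD inE.
by rewrite prod_edgeE e /b; case: (eqVneq a (Ordinal n2)) => [->|].
Qed.

End Product.

(** The product is two disjoint copies of [G]: the copy of [(x, a)] is the
    parity [cls] of the side of [x] and of [a], which is constant along edges.
    Each copy has one vertex over each [x], dominated inside that copy. *)
Lemma ind_dom_number_bipartite (G : sgraph) (col : G -> bool) :
  (forall x y, edge x y -> col x != col y) -> (forall x : G, #|cnbhd x| <= 3) ->
  2 * ceil_div #|G| 3 <= ind_dom_number (direct_product G (complete_graph 2)).
Proof.
move=> bip d; apply: leq_ind_dom_number => I _ dI.
pose cls := fun p : direct_product G (complete_graph 2) => col p.1 (+) (p.2 == ord0).
have half s : ceil_div #|G| 3 <= #|[set p in I | cls p == s]|.
  rewrite ceil_div_leq // mulnC; apply: leq_trans (sum_near_leq _ d).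
  rewrite -sum1_card; apply: leq_sum => x _; rewrite card_gt0; apply/set0Pn.
  have [a ca] : exists a : 'I_2, (a == ord0) = col x (+) s.
    by exists (if col x (+) s then ord0 else ord_max); case: (_ (+) _).
  case: (near_dominator x a dI) => -[y b]; rewrite inE => /andP[yI yx] h.
  exists (y, b); rewrite !inE yI -in_cnbhd yx andbT /= /cls /=.
  move: h yx; rewrite /= inE; case: (eqVneq y x) => [-> /eqP-> _|_ ba /bip].
    by rewrite ca addKb.
  have -> : (b == ord0) = ~~ (a == ord0).
    by move: b a ba {ca yI} => [[|[|]]//= ?] [[|[|]]//= ?].
  by rewrite ca; clear; case: (col x); case: (col y); case: s.
rewrite mul2n -addnn; apply: leq_trans (leq_add (half true) (half false)) _.
rewrite -cardsUI (_ : _ :&: _ = set0) ?cards0 ?addn0.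
  by apply: subset_leq_card; apply/subsetP => p; rewrite !inE -andb_orr => /andP[].
by apply/setP => p; rewrite !inE; case: (p \in I) => //; case: (cls p).
Qed.

(** * Lower bounds for paths and cycles *)

Lemma card_ord_vals m (A : {set 'I_m}) (s : seq nat) :
  {in A, forall x, val x \in s} -> #|A| <= size s.
Proof.
move=> As; rewrite cardE -(size_map val); apply: uniq_leq_size.
  by rewrite map_inj_uniq ?enum_uniq //; apply: val_inj.
by move=> v /mapP[x]; rewrite mem_enum => /As xs ->.
Qed.

Lemma path_edgeE m (x y : 'I_m) :
  @edge (path_graph m) x y = (x.+1 == y) || (y.+1 == x).
Proof. by []. Qed.

Lemma cycle_edgeE m (x y : 'I_m) : 1 < m ->
  @edge (cycle_graph m) x y =
    [|| x.+1 == y, y.+1 == x, (x.+1 == m) && (y == 0 :> nat) |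
        (y.+1 == m) && (x == 0 :> nat)].
Proof.
move=> m1; rewrite /= /cycle_edge.
have succ_mod (u v : 'I_m) : (u.+1 == v %[mod m]) =
    (u.+1 == v) || ((u.+1 == m) && (v == 0 :> nat)).
  rewrite (modn_small (ltn_ord v)); have := ltn_ord u.
  rewrite leq_eqVlt => /orP[/eqP um|um]; last first.
    by rewrite modn_small // (ltn_eqF um) orbF.
  by rewrite um modnn eqxx eq_sym orbC; have := ltn_ord v; case: eqP => //; lia.
rewrite !succ_mod -(inj_eq val_inj) /=.
have := ltn_ord x; have := ltn_ord y; lia.
Qed.

Lemma path_cycle_edge m (x y : 'I_m) : 1 < m ->
  @edge (path_graph m) x y -> @edge (cycle_graph m) x y.
Proof. by move=> m1; rewrite cycle_edgeE // path_edgeE orbA => ->. Qed.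

Lemma path_cnbhd m (x : 'I_m) : #|@cnbhd (path_graph m) x| <= 3.
Proof.
apply: (@card_ord_vals _ _ [:: x.-1; val x; x.+1]) => y.
rewrite (@in_cnbhd (path_graph m)) path_edgeE !inE => /or3P[/eqP->|/eqP->|/eqP<-];
  by rewrite eqxx ?orbT.
Qed.

Lemma cycle_cnbhd m (x : 'I_m) : 1 < m -> #|@cnbhd (cycle_graph m) x| <= 3.
Proof.
move=> m1; have xm := ltn_ord x.
pose p := if x == 0 :> nat then m.-1 else x.-1.
pose q := if x.+1 == m then 0 else x.+1.
apply: (@card_ord_vals _ _ [:: p; val x; q]) => y.
rewrite (@in_cnbhd (cycle_graph m)) cycle_edgeE // -(inj_eq val_inj) !inE /p /q /=.
have := ltn_ord (y : 'I_m); do 2 case: ifP; lia.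
Qed.

(** The end vertices have closed neighbourhoods of size 2, so the points in the
    two end columns can be added once more to the double count without exceeding
    [3 * #|I|].  If both end columns are nonempty this adds 2; otherwise
    [leaf_sum_near] applies. *)
Lemma path_card_geq m n (I : {set direct_product (path_graph m) (complete_graph n)}) :
  2 < m -> 2 < n -> independent I -> dominating I ->
  2 * m + 2 <= 3 * #|I|.
Proof.
move=> m3 n3 iI dI.
have m0 : 0 < m by lia.
have m1 : 1 < m by lia.
have ml : m.-1 < m by lia.
have mp : m.-2 < m by lia.
pose u : path_graph m := Ordinal m0; pose v : path_graph m := Ordinal ml.
pose cnt (w : path_graph m) := \sum_(p in I) (p.1 == w : nat).
have cnt0 w : (forall a, (w, a) \notin I) \/ 0 < cnt w.
  case: (pickP [pred a | (w, a) \in I]) => [a /= wa|none]; [right|left] => [|a].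
    by rewrite /cnt (bigD1 (w, a)) //= eqxx.
  by rewrite (negbT (none a)).
have ub : \sum_z #|near I z| + cnt u + cnt v <= 3 * #|I|.
  rewrite sum_near /cnt -!big_split /= mulnC -sum_nat_const.
  apply: leq_sum => -[x a] _ /=.
  have Nu : #|cnbhd u| <= 2.
    apply: (@card_ord_vals _ _ [:: 0; 1]) => y.
    rewrite (@in_cnbhd (path_graph m)) path_edgeE -(inj_eq val_inj) !inE /=; lia.
  have Nv : #|cnbhd v| <= 2.
    apply: (@card_ord_vals _ _ [:: m.-2; m.-1]) => y.
    rewrite (@in_cnbhd (path_graph m)) path_edgeE -(inj_eq val_inj) !inE /=.
    have := ltn_ord (y : 'I_m); lia.
  have uv : u != v by rewrite -(inj_eq val_inj) /=; lia.
  case: (eqVneq x u) => [->|_]; first by rewrite (negbTE uv) addn0 addn1.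
  case: (eqVneq x v) => [->|_]; first by rewrite addn0 addn1.
  by rewrite !addn0 path_cnbhd.
have lb : 2 * m <= \sum_z #|near I z|.
  by rewrite -[m in 2 * m]card_ord; apply: sum_near_geq => //; apply: ltnW.
have leaf (x y : path_graph m) : x != y -> cnbhd x \subset [set x; y] -> edge x y ->
    (forall a, (x, a) \notin I) -> 2 * m + 2 <= \sum_z #|near I z|.
  by rewrite -[m in 2 * m]card_ord; apply: leaf_sum_near.
have [u0|u1] := cnt0 u.
  suff : 2 * m + 2 <= \sum_z #|near I z| by lia.
  apply: (leaf u (Ordinal m1 : 'I_m)) => //.
  apply/subsetP => y; rewrite !inE; case/orP => [->//|].
  by rewrite path_edgeE -!(inj_eq val_inj) /=; lia.
have [v0|v1] := cnt0 v; last by lia.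
suff : 2 * m + 2 <= \sum_z #|near I z| by lia.
apply: (leaf v (Ordinal mp : 'I_m)) => //.
- by rewrite -(inj_eq val_inj) /=; lia.
- apply/subsetP => y; rewrite !inE; case/orP => [->//|].
  rewrite path_edgeE -!(inj_eq val_inj) /=; have := ltn_ord (y : 'I_m); lia.
- rewrite path_edgeE /=; lia.
Qed.

Lemma path_complete_geq m n : 2 < m -> 2 < n -> ceil_div (2 * m + 2) 3 <=
  ind_dom_number (direct_product (path_graph m) (complete_graph n)).
Proof.
move=> m3 n3; apply: leq_ind_dom_number => I iI dI.
by rewrite ceil_div_leq // (mulnC #|I|) path_card_geq.
Qed.

Lemma path_K2_geq m : 2 * ceil_div m 3 <=
  ind_dom_number (direct_product (path_graph m) (complete_graph 2)).
Proof.
rewrite -[m in ceil_div m]card_ord.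
apply: (@ind_dom_number_bipartite (path_graph m) (fun x => odd (x : 'I_m))).
  by move=> x y; rewrite path_edgeE => /orP[]/eqP<- /=; case: odd.
exact: path_cnbhd.
Qed.

Lemma even_cycle_K2_geq m : 1 < m -> ~~ odd m -> 2 * ceil_div m 3 <=
  ind_dom_number (direct_product (cycle_graph m) (complete_graph 2)).
Proof.
move=> m1 me; rewrite -[m in ceil_div m]card_ord.
apply: (@ind_dom_number_bipartite (cycle_graph m) (fun x => odd (x : 'I_m))).
  by move=> x y; rewrite cycle_edgeE //; lia.
by move=> x; apply: cycle_cnbhd.
Qed.

Lemma cycle_geq m n : 1 < m -> 1 < n -> ceil_div (2 * m) 3 <=
  ind_dom_number (direct_product (cycle_graph m) (complete_graph n)).
Proof.
move=> m1 n1; rewrite -[m in ceil_div (2 * m)]card_ord.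
by apply: ind_dom_number_prod_geq => // x; apply: cycle_cnbhd.
Qed.

(** Two arcs [j, p, p'] and [j, q, q'] leaving [j] in opposite directions use up
    all five vertices if they are disjoint, and then their ends are adjacent; on
    a shorter cycle they overlap. *)
Lemma short_cycle_arcs_meet m (j p q p' q' : cycle_graph m) : 2 < m <= 5 ->
  edge j p -> edge j q -> edge p p' -> edge q q' ->
  p != q -> p' != j -> q' != j -> (p' == q') || edge p' q'.
Proof.
case/andP => m3 m5; have m1 : 1 < m by lia.
rewrite !cycle_edgeE // -!(inj_eq val_inj) /=.
move: (ltn_ord (j : 'I_m)) (ltn_ord (p : 'I_m)) (ltn_ord (q : 'I_m)).
move: (ltn_ord (p' : 'I_m)) (ltn_ord (q' : 'I_m)).
move: (nat_of_ord j) (nat_of_ord p) (nat_of_ord q) => {}j {}p {}q.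
move: (nat_of_ord p') (nat_of_ord q') => {}p' {}q' p'm q'm jm pm qm.
move=> jp jq pp' qq' pq p'j q'j.
have : [|| m == 3, m == 4 | m == 5] by lia.
(* Deciding one vertex at a time keeps the enumeration small, as each new
   vertex must be a neighbour of an earlier one. *)
by case/or3P => /eqP mE; subst m; case: j jm jp jq p'j q'j => [|[|[|[|[|//]]]]] // _;
  case: p pm pq pp' => [|[|[|[|[|//]]]]] //= _ pq pp' _;
  case: q qm pq qq' => [|[|[|[|[|//]]]]] //= _ _ qq' _;
  case: p' p'm pp' => [|[|[|[|[|//]]]]] //= _ _ _;
  case: q' q'm qq' => [|[|[|[|[|//]]]]].
Qed.

(** If some column has two points, it is full; this suffices for [m = 3], and
    otherwise the at least two points near a vertex not adjacent to it are
    further ones.  If every column has at most one point and the one over [j] is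
    empty, the neighbours of [j] carry points of two colours, each of which
    needs a further neighbour of its own colour; [short_cycle_arcs_meet] brings
    the two colours into conflict. *)
Lemma small_cycle_geq m n : 2 < m <= 5 -> 2 < n ->
  m <= ind_dom_number (direct_product (cycle_graph m) (complete_graph n)).
Proof.
move=> m35 n3; have /andP[m3 m5] := m35; have m1 := ltnW m3.
apply: leq_ind_dom_number => I iI dI.
have [/existsP[x /existsP[a /existsP[b /and3P[xa xb ab]]]]|] :=
  boolP [exists x : cycle_graph m, exists a : 'I_n, exists b : 'I_n,
    [&& (x, a) \in I, (x, b) \in I & a != b]].
  have full := column_full iI dI xa xb ab.
  have sI : column n x \subset I.
    by apply/subsetP => -[y c]; rewrite inE /= => /eqP->.
  have [m_le3|m_gt3] := leqP m 3.
    apply: leq_trans (subset_leq_card sI); rewrite card_column; lia.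
  have /subsetPn[z _ zx] : ~~ ([set: cycle_graph m] \subset cnbhd x).
    apply/negP => /subset_leq_card; rewrite cardsT card_ord => le.
    have := leq_trans le (cycle_cnbhd _ m1); lia.
  have dis : [disjoint column n x & near I z].
    rewrite disjoint_subset; apply/subsetP => -[y c]; rewrite inE => /eqP /= ->.
    by rewrite inE; apply: contra zx; rewrite inE cnbhd_sym => /andP[].
  have := near_geq2 z (ltnW n3) dI; have := card_column n x.
  have : #|column n x :|: near I z| <= #|I|.
    apply: subset_leq_card; rewrite subUset sI /=.
    by apply/subsetP => p; rewrite inE => /andP[].
  rewrite cardsU disjoint_setI0 // cards0 subn0; lia.
rewrite negb_exists => /forallP thin.
have uniq_col x a b : (x, a) \in I -> (x, b) \in I -> a = b.
  move=> xa xb; apply/eqP; apply: contraT => ab.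
  move: (thin x); rewrite negb_exists => /forallP/(_ a).
  by rewrite negb_exists => /forallP/(_ b); rewrite xa xb ab.
have [/forallP full|] := boolP [forall x : cycle_graph m, [exists a : 'I_n, (x, a) \in I]].
  apply: leq_trans (leq_imset_card (fun p : direct_product _ _ => p.1) (mem I)).
  rewrite -[X in X <= _]card_ord; apply: subset_leq_card; apply/subsetP => x _.
  by case/existsP: (full x) => a xa; apply/imsetP; exists (x, a).
rewrite negb_forall => /existsP[j]; rewrite negb_exists => /forallP jN.
have dom x a : (x, a) \notin I -> exists y b, [/\ (y, b) \in I, edge x y, a != b & y != j].
  case/(dominatingP _ dI) => -[y b] yb; rewrite prod_edgeE => /andP[e ab].
  exists y, b; split=> //; apply: contraTneq yb => ->; exact: jN.
have nadj x a y b : (x, a) \in I -> (y, b) \in I -> edge x y -> a = b.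
  move=> xa yb e; apply/eqP; move/independentP: iI => /(_ _ _ xa yb).
  by rewrite prod_edgeE e /= negbK.
have arc x a b : (x, a) \in I -> b != a -> exists y, [/\ (y, a) \in I, edge x y & y != j].
  move=> xa ba; have [|y [c [yc e _ yj]]] := dom x b.
    by apply: contra ba => xb; rewrite (uniq_col _ _ _ xb xa).
  by exists y; rewrite (nadj _ _ _ _ xa yc e).
have [p [a [pa jp _ _]]] := dom j (Ordinal (ltnW (ltnW n3))) (jN _).
have [q [b [qb jq ab _]]] := dom j a (jN _).
have pq : p != q.
  by apply: contra ab => /eqP pq; rewrite pq in pa; rewrite (uniq_col _ _ _ pa qb).
have [p' [pa' pp' pj]] : exists y, [/\ (y, a) \in I, edge p y & y != j].
  by apply: (arc _ _ b); rewrite // eq_sym.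
have [q' [qb' qq' qj]] := arc _ _ _ qb ab.
case/orP: (short_cycle_arcs_meet m35 jp jq pp' qq' pq pj qj) => [/eqP pqE|e].
  by rewrite pqE in pa'; rewrite (uniq_col _ _ _ pa' qb') eqxx in ab.
by rewrite (nadj _ _ _ _ pa' qb' e) eqxx in ab.
Qed.

(** * Sparse independent dominating sets and products with [K_2] *)

Lemma sum_blocks (f : nat -> nat) s q c :
  (forall j, f (s + 3 * j) + f (s + 3 * j).+1 + f (s + 3 * j).+2 = c) ->
  \sum_(i < s + 3 * q) f i = \sum_(i < s) f i + q * c.
Proof.
move=> fc; elim: q => [|q IH]; first by rewrite muln0 mul0n !addn0.
have -> : s + 3 * q.+1 = (s + 3 * q).+3 by lia.
rewrite 3!big_ord_recr /= IH mulSn; have := fc q; move: (\sum_(i < s) f i) (f _) (f _) (f _); lia.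
Qed.

Lemma card_ord_pred m (P : pred nat) :
  #|[pred i : 'I_m | P i]| = \sum_(i < m) (P i : nat).
Proof.
rewrite -sum1_card big_mkcond /=; apply: eq_bigr => i _.
by rewrite inE; case: (P i).
Qed.

(** Cut the vertices into [d] blocks of two followed by blocks of three, and take
    the second vertex of every block.  Each block is dominated from within, so
    the path suffices for domination; no block starts with a chosen vertex, so
    independence survives closing up the cycle. *)
Lemma sparse_set m : 2 < m -> exists D : {set 'I_m},
  [/\ @independent (cycle_graph m) D, @dominating (path_graph m) D
    & #|D| = ceil_div m 3].
Proof.
move=> m3; have m1 := ltnW m3; set k := ceil_div m 3.
have [d [q [d2 mE kE]]] : exists d q, [/\ d <= 2, m = 2 * d + 3 * q & k = d + q].
  (* [k] blocks of three would cover [3 * k - m] vertices too many *)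
  by exists (3 * k - m), (k - (3 * k - m)); rewrite /k /ceil_div /=; split; lia.
pose t i := if i < 2 * d then odd i else (i - 2 * d) %% 3 == 1.
have t0 : ~~ t 0 by rewrite /t; case: ifP => //; lia.
have tS i : t i -> ~~ t i.+1 by rewrite /t; do 2 case: ifP => ?; lia.
have tD i : i < m -> ~~ t i -> (0 < i /\ t i.-1) \/ (i.+1 < m /\ t i.+1).
  by rewrite /t; do 3 case: ifP => ?; lia.
exists [set i : 'I_m | t i]; split.
- apply/independentP => x y; rewrite !inE cycle_edgeE // => tx ty; apply/negP.
  case/or4P => [/eqP xy|/eqP yx|/andP[_ /eqP y0]|/andP[_ /eqP x0]].
  + by move: (tS _ tx); rewrite xy ty.
  + by move: (tS _ ty); rewrite yx tx.
  + by rewrite y0 (negbTE t0) in ty.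
  + by rewrite x0 (negbTE t0) in tx.
- apply/dominatingP => x; rewrite inE => /(tD _ (ltn_ord x))[[x0 tx]|[xm tx]].
    have xm : x.-1 < m by have := ltn_ord x; lia.
    by exists (Ordinal xm); rewrite ?inE // path_edgeE /= prednK // eqxx orbT.
  by exists (Ordinal xm); rewrite ?inE // path_edgeE /= eqxx.
- rewrite kE cardsE card_ord_pred mE (@sum_blocks (fun i => t i : nat) _ _ 1) => [|j].
    rewrite muln1; congr (_ + _).
    under eq_bigr do rewrite /t ltn_ord.
    elim: (d) => [|e IH]; first by rewrite big_ord0.
    have -> : 2 * e.+1 = (2 * e).+2 by lia.
    by rewrite 2!big_ord_recr /= IH mul2n odd_double addn0 addn1.
  by rewrite /t; do 3 case: ifP => ?; lia.
Qed.

Lemma path_dominating_cycle m (D : {set 'I_m}) : 1 < m ->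
  @dominating (path_graph m) D -> @dominating (cycle_graph m) D.
Proof.
move=> m1 /dominatingP dD; apply/dominatingP => x /dD[y yD e].
by exists y => //; apply: path_cycle_edge.
Qed.

Lemma path_independent_cycle m (D : {set 'I_m}) : 1 < m ->
  @independent (cycle_graph m) D -> @independent (path_graph m) D.
Proof.
move=> m1 /independentP iD; apply/independentP => x y xD yD.
by apply: contra (iD _ _ xD yD); apply: path_cycle_edge.
Qed.

Lemma path_K2_leq m : 2 < m ->
  ind_dom_number (direct_product (path_graph m) (complete_graph 2))
    <= 2 * ceil_div m 3.
Proof.
move=> m3; have [D [iD dD <-]] := sparse_set m3; rewrite mulnC.
apply: (@ind_dom_number_prod_leq (path_graph m)) => //.
exact: path_independent_cycle (ltnW m3) iD.
Qed.

Lemma cycle_K2_leq m : 2 < m ->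
  ind_dom_number (direct_product (cycle_graph m) (complete_graph 2))
    <= 2 * ceil_div m 3.
Proof.
move=> m3; have [D [iD dD <-]] := sparse_set m3; rewrite mulnC.
apply: (@ind_dom_number_prod_leq (cycle_graph m)) => //.
exact: path_dominating_cycle (ltnW m3) dD.
Qed.

Lemma cycle_leq m : 2 < m -> ind_dom_number (cycle_graph m) <= ceil_div m 3.
Proof.
move=> m3; have [D [iD dD <-]] := sparse_set m3.
exact: ind_dom_number_leq iD (path_dominating_cycle (ltnW m3) dD).
Qed.

(** For odd [m], reduction modulo [m] and modulo 2 is an isomorphism from the
    cycle of length [2 * m] onto the product. *)
Lemma odd_cycle_K2_leq m : 2 < m -> odd m ->
  ind_dom_number (direct_product (cycle_graph m) (complete_graph 2))
    <= ceil_div (2 * m) 3.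
Proof.
move=> m3 mo; have m0 : 0 < m by lia.
apply: leq_trans (cycle_leq _); last by lia.
have co : coprime 2 m by rewrite coprime2n.
pose f (t : 'I_(2 * m)) : direct_product (cycle_graph m) (complete_graph 2) :=
  (Ordinal (ltn_pmod t m0), Ordinal (ltn_pmod t (isT : 0 < 2))).
apply: (@ind_dom_number_iso_leq (cycle_graph (2 * m)) _ f).
  apply: inj_card_bij; last by rewrite card_prod !card_ord mulnC.
  move=> s t [stm st2]; apply: val_inj => /=.
  rewrite -(modn_small (ltn_ord s)) -(modn_small (ltn_ord t)).
  by apply/eqP; rewrite chinese_remainder // stm st2 !eqxx.
move=> s t; rewrite /f prod_edgeE /= /cycle_edge -!(inj_eq val_inj) /=.
have modS (u v : nat) : ((u %% m).+1 == v %% m %[mod m]) = (u.+1 == v %[mod m]).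
  by rewrite modn_mod -addn1 modnDml addn1.
have parity (u v : nat) : (u.+1 == v %[mod 2]) = (u %% 2 != v %% 2) by lia.
have neq (u v : nat) : u.+1 = v %[mod m] -> u <> v %[mod m].
  move=> uv uv'; move: uv; rewrite -uv' -addn1 -[in RHS](addn0 u) => /eqP.
  by rewrite eqn_modDl mod0n modn_small ?(ltnW m3).
rewrite !modS !chinese_remainder // !parity (eq_sym (t %% 2)).
case: (eqVneq (s %% 2) (t %% 2)) => [_|st2]; first by rewrite !andbF.
have -> /= : s != t :> nat by apply: contraNneq st2 => ->.
rewrite andbT; case: (eqVneq (s %% m) (t %% m)) => //= stm.
by apply/esym/norP; split; apply/eqP => /neq; apply; rewrite stm.
Qed.

(** * Colourings of long cycles and of paths *)

Lemma small_cycle_leq m n : 1 < m -> 0 < n ->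
  ind_dom_number (direct_product (cycle_graph m) (complete_graph n)) <= m.
Proof.
move=> m1 n0; rewrite -[X in _ <= X]card_ord.
apply: (@ind_dom_number_colouring (cycle_graph m) n xpredT (fun=> Ordinal n0)) => //.
move=> x _; have := ltn_ord (x : 'I_m); rewrite leq_eqVlt => /orP[xm|xm].
  by exists (Ordinal (ltnW m1)); rewrite // cycle_edgeE //= xm ?orbT.
by exists (Ordinal xm); rewrite // cycle_edgeE //= eqxx.
Qed.

(** On a cycle of length [M] the cells are grouped in blocks of the shape [qq_],
    where [q] is the colour and [_] a dead cell.  The truncated subtraction
    turns the first [M %% 3] cells into copies of the first cell of block 0, so
    that the length is met while the last cell is dead. *)
Definition live M i := (i - M %% 3) %% 3 != 2.

(** Colours alternate between 0 and 1; the last block gets the third colour,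
    because it is cyclically next to block 0, which would have its colour if the
    number of blocks were odd. *)
Definition colour M i : nat :=
  let q := (i - M %% 3) %/ 3 in if q.+1 == M %/ 3 then 2 else odd q.

Lemma colour_lt3 M i : colour M i < 3.
Proof. by rewrite /colour; case: ifP => // _; case: odd. Qed.

Lemma live_colour_step M i : live M i -> live M i.+1 -> colour M i.+1 = colour M i.
Proof.
rewrite /live /colour => li lS.
by have -> : (i.+1 - M %% 3) %/ 3 = (i - M %% 3) %/ 3 by lia.
Qed.

Lemma live_last M : 2 < M -> ~~ live M M.-1.
Proof. rewrite /live; lia. Qed.

Lemma live_neighbour M i : 2 < M -> i < M -> live M i ->
  (0 < i /\ live M i.-1) \/ (i.+2 < M /\ live M i.+1).
Proof.
rewrite /live => M3 iM li; have := divn_eq M 3; have := divn_eq (i - M %% 3) 3.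
case: (posnP i) => [->|i0]; lia.
Qed.

Lemma dead_neighbours M i : i.+1 < M -> ~~ live M i ->
  [/\ 0 < i, live M i.-1, live M i.+1, i.+2 < M & colour M i.-1 != colour M i.+1].
Proof.
rewrite /live /colour => iM li.
have [-> ->] : (i.-1 - M %% 3) %/ 3 = (i - M %% 3) %/ 3 /\
               (i.+1 - M %% 3) %/ 3 = ((i - M %% 3) %/ 3).+1 by lia.
split; try lia.
by do 2 case: ifP => //=; lia.
Qed.

(** Up to [M = 5] there is only one block and the last, dead cell would see a
    single colour. *)
Lemma colour_wrap M : 5 < M -> colour M M.-2 != colour M 0.
Proof.
rewrite /colour => M6.
have -> : (M.-2 - M %% 3) %/ 3 = (M %/ 3).-1 by lia.
do 2 case: ifP => //=; lia.
Qed.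

Lemma sum_live M : 2 < M -> \sum_(i < M) (live M i : nat) = ceil_div (2 * M) 3.
Proof.
move=> M3; rewrite -(big_mkord xpredT (fun i => live M i : nat)).
rewrite {1}(divn_eq M 3) addnC mulnC big_mkord.
rewrite (@sum_blocks (fun i => live M i : nat) _ _ 2) => [|j]; last by rewrite /live; lia.
under eq_bigr => i _.
  have -> : live M i by rewrite /live; have := ltn_ord i; lia.
over.
rewrite sum_nat_const card_ord /ceil_div /=; lia.
Qed.

Definition colour_ord n (n3 : 2 < n) M i : 'I_n :=
  Ordinal (leq_trans (colour_lt3 M i) n3).

Lemma cycle_complete_leq m n : 5 < m -> 2 < n ->
  ind_dom_number (direct_product (cycle_graph m) (complete_graph n))
    <= ceil_div (2 * m) 3.
Proof.
move=> m6 n3; have m3 : 2 < m by lia.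
have m1 := ltnW m3; have m0 := ltnW m1.
rewrite -sum_live // -card_ord_pred.
apply: (@ind_dom_number_colouring (cycle_graph m) n
  [pred i : 'I_m | live m i] (fun i => colour_ord n3 m (i : 'I_m))).
  (* the wrap-around edge has the dead last cell as an end *)
- have l0 (u v : 'I_m) : live m u -> (u.+1 == m) && (v == 0 :> nat) = false.
    move=> lu; apply: contraTF lu => /andP[/eqP um _].
    by rewrite -[nat_of_ord u]/(u.+1.-1) um live_last.
  move=> x y lx ly; rewrite cycle_edgeE // !l0 // !orbF => e; apply: val_inj => /=.
  by case/orP: e => /eqP e; move: lx ly; rewrite /= -e => lx ly; rewrite live_colour_step.
- move=> x /(live_neighbour m3 (ltn_ord (x : 'I_m)))[[x0 lx]|[xm lx]].
    have xm : (x : 'I_m).-1 < m by have := ltn_ord (x : 'I_m); lia.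
    by exists (Ordinal xm : 'I_m); rewrite // cycle_edgeE //= prednK // eqxx orbT.
  by exists (Ordinal (ltnW xm) : 'I_m); rewrite // cycle_edgeE //= eqxx.
- move=> x lx; have := ltn_ord (x : 'I_m); rewrite leq_eqVlt => /orP[xm|xm].
    have p : m.-2 < m by lia.
    exists (Ordinal p : 'I_m), (Ordinal m0 : 'I_m); split; rewrite ?cycle_edgeE //=.
    + by rewrite /live; lia.
    + by rewrite /live; lia.
    + by lia.
    + exact: colour_wrap.
  have [x0 lp ls _ c] := dead_neighbours xm lx.
  have p : (x : 'I_m).-1 < m by have := ltn_ord (x : 'I_m); lia.
  exists (Ordinal p : 'I_m), (Ordinal xm : 'I_m); split; rewrite ?cycle_edgeE //=.
    by rewrite prednK // eqxx orbT.
  by rewrite eqxx.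
Qed.

(** The colouring of the cycle of length [m + 1] ends in a dead cell, so it loses
    no coloured vertex when that cell is removed. *)
Lemma path_complete_leq m n : 2 < m -> 2 < n ->
  ind_dom_number (direct_product (path_graph m) (complete_graph n))
    <= ceil_div (2 * m + 2) 3.
Proof.
move=> m3 n3; have M3 : 2 < m.+1 := ltnW m3.
have -> : 2 * m + 2 = 2 * m.+1 by lia.
rewrite -sum_live // big_ord_recr /= (negbTE (live_last M3)) addn0 -card_ord_pred.
apply: (@ind_dom_number_colouring (path_graph m) n
  [pred i : 'I_m | live m.+1 i] (fun i => colour_ord n3 m.+1 (i : 'I_m))).
- move=> x y lx ly; rewrite path_edgeE => e; apply: val_inj => /=.
  by case/orP: e => /eqP e; move: lx ly; rewrite /= -e => lx ly; rewrite live_colour_step.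
- move=> x /(live_neighbour M3 (ltnW (ltn_ord (x : 'I_m))))[[x0 lx]|[xm lx]].
    have xm : (x : 'I_m).-1 < m by have := ltn_ord (x : 'I_m); lia.
    by exists (Ordinal xm : 'I_m); rewrite // path_edgeE /= prednK // eqxx orbT.
  by exists (Ordinal (xm : (x : 'I_m).+1 < m) : 'I_m); rewrite // path_edgeE /= eqxx.
- move=> x lx.
  have [x0 lp ls xm c] := @dead_neighbours m.+1 _ (ltn_ord (x : 'I_m)) lx.
  have p : (x : 'I_m).-1 < m by have := ltn_ord (x : 'I_m); lia.
  exists (Ordinal p : 'I_m), (Ordinal (xm : (x : 'I_m).+1 < m) : 'I_m).
  split; rewrite ?path_edgeE //=.
    by rewrite prednK // eqxx orbT.
  by rewrite eqxx.
Qed.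

Theorem proposition6 (m n : nat) (hm : 3 <= m) (hn : 3 <= n) :
  (* (a) *)
  ind_dom_number (direct_product (path_graph m) (complete_graph 2))
    = 2 * ceil_div m 3
  /\
  (* (b) *)
  ((odd m ->
     ind_dom_number (direct_product (cycle_graph m) (complete_graph 2))
       = ceil_div (2 * m) 3) /\
   (~~ odd m ->
     ind_dom_number (direct_product (cycle_graph m) (complete_graph 2))
       = 2 * ceil_div m 3))
  /\
  (* (c) *)
  ((3 <= m <= 5 ->
     ind_dom_number (direct_product (cycle_graph m) (complete_graph n)) = m) /\
   (6 <= m ->
     ind_dom_number (direct_product (cycle_graph m) (complete_graph n))
       = ceil_div (2 * m) 3))
  /\
  (* (d) *)
  ind_dom_number (direct_product (path_graph m) (complete_graph n))
    = ceil_div (2 * m + 2) 3.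
Proof.
have m1 := ltnW hm; have n1 := ltnW hn.
split; first by apply/eqP; rewrite eqn_leq path_K2_leq ?path_K2_geq.
split.
  split=> [mo|me]; apply/eqP; rewrite eqn_leq.
    by rewrite odd_cycle_K2_leq ?cycle_geq.
  by rewrite cycle_K2_leq ?even_cycle_K2_geq.
split; last by apply/eqP; rewrite eqn_leq path_complete_leq ?path_complete_geq.
split=> [m35|m6]; apply/eqP; rewrite eqn_leq.
  by rewrite small_cycle_leq ?small_cycle_geq // ltnW.
by rewrite cycle_complete_leq ?cycle_geq.
Qed.
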